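(* Let $(x_n)_n$ be a frame for a Hilbert space $H$ with the analysis operator $U$ and the canonical dual $(y_n)_n$. Suppose that a finite set of indices $E=\{n_1,n_2,\ldots,n_k\}$, $k\in\mathbb N$ (with $n_1,\ldots,n_k$ distinct), satisfies the minimal redundancy condition for $(x_n)_n$. Let $(v_n)_n$ be the dual frame of $(x_n)_n$ defined by $$v_{n}=0 \ \ (n\in E),\qquad v_n=y_n-\sum_{i=1}^k\alpha_{ni}y_{n_i}\ \ (n\notin E),$$ where, for each $n\notin E$, $(\alpha_{n1},\ldots,\alpha_{nk})$ is the unique solution of the linear system $$\sum_{j=1}^k\langle y_{n_j},x_{n_i}\rangle\alpha_{nj}-\alpha_{ni}=\langle y_n,x_{n_i}\rangle,\qquad i=1,\ldots,k.$$ Then $$v_n=(I-V_E^*U_E)^{-1}y_n,\qquad \forall n\notin E,$$ where $V_E^*U_E\in\mathbb B(H)$ is the operator $V_E^*U_Ex=\sum_{i=1}^k\langle x,x_{n_i}\rangle y_{n_i}$, $x\in H$.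
   Context: Convention: $H$ is a complex Hilbert space with inner product linear in the first argument; sequences $(x_n)_n$ are indexed by a set $J$, where either $J=\mathbb{N}=\{1,2,\ldots\}$ and $H$ is infinite-dimensional and separable, or $J=\{1,\ldots,M\}$ for some $M\in\mathbb N$ and $H$ is finite-dimensional. $\mathbb B(H)$ is the set of bounded operators on $H$. The sequence $(x_n)_n$ is a frame for $H$ if there are constants $A,B>0$ with $A\|x\|^2\le\sum_{n}|\langle x,x_n\rangle|^2\le B\|x\|^2$ for all $x\in H$. Its analysis operator is $U:H\to\ell^2(J)$, $Ux=(\langle x,x_n\rangle)_n$; the frame operator $U^*U$ is invertible, and the canonical dual is the frame $(y_n)_n$, $y_n=(U^*U)^{-1}x_n$. A frame $(v_n)_n$ for $H$ is dual to $(x_n)_n$ if $x=\sum_n\langle x,x_n\rangle v_n$ for all $x\in H$. A finite set of indices $E\subseteq J$ satisfies the minimal redundancy condition for $(x_n)_n$ if $\overline{\mathrm{span}}\{x_n: n\in J\setminus E\}=H$. For finite $E=\{n_1,\ldots,n_k\}$, $U_E,V_E:H\to\mathbb C^k$ denote the analysis operators of $(x_n)_{n\in E}$ and $(y_n)_{n\in E}$: $U_Ex=(\langle x,x_{n_i}\rangle)_{i=1}^k$, $V_Ex=(\langle x,y_{n_i}\rangle)_{i=1}^k$. *)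

(* Defs.v *)
From HB Require Import structures.
From mathcomp Require Import all_boot all_order all_algebra complex.
From mathcomp Require Import all_classical all_reals all_analysis.

Set Implicit Arguments.
Unset Strict Implicit.
Unset Printing Implicit Defensive.

Import Order.TTheory GRing.Theory Num.Theory.
Import numFieldNormedType.Exports.

Local Open Scope classical_set_scope.
Local Open Scope complex_scope.
Local Open Scope ring_scope.

(* [R[i]] does not inherit the topology and norm that [R[i]^o] has as a
   numFieldType. *)
HB.instance Definition _ (R : rcfType) := GRing.ComAlgebra.copy R[i] R[i]^o.
HB.instance Definition _ (R : rcfType) := NormedModule.copy R[i] R[i]^o.

Section Frames.
Context {R : realType}.
Local Notation C := R[i].

Section Hilbert.
Context {H : completeNormedModType C}.

(* [\sum_(n in J) f n = s], the sum being taken in the order of the indices;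
   the partial sums are eventually constant when [J] is finite. *)
Definition has_sum (V : normedModType C) (J : set nat) (f : nat -> V) (s : V) :=
  (fun N => \sum_(0 <= n < N | n \in J) f n) @ \oo --> s.

Definition lin_span (A : set H) : set H :=
  [set y | exists k (c : 'I_k -> C) (a : 'I_k -> H),
     (forall i, A (a i)) /\ y = \sum_(i < k) c i *: a i].

Definition finite_dim := exists2 A : set H, finite_set A & lin_span A = setT.

Definition separable := exists2 D : set H, countable D & dense D.

Definition is_index_set (J : set nat) :=
  [/\ J = [set n | (1 <= n)%N], ~ finite_dim & separable] \/
  (exists M, [/\ (1 <= M)%N, J = [set n | (1 <= n <= M)%N] & finite_dim]).

Definition bounded_op (T : H -> H) :=
  linear T /\ exists M : R, forall h, `|T h| <= M%:C * `|h|.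

Definition is_inverse (T T' : H -> H) :=
  [/\ bounded_op T, bounded_op T', cancel T T' & cancel T' T].

Definition invertible (T : H -> H) := exists T', is_inverse T T'.

(* A junk value when [T] is not invertible. *)
Definition op_inv (T : H -> H) : H -> H := get (is_inverse T).

Section InnerProduct.
Variable dot : {dot H for @Num.conj C}.

Definition is_frame (J : set nat) (x : nat -> H) :=
  exists A B : R, [/\ 0 < A, 0 < B & forall h, exists s : C,
    has_sum J (fun n => `|dot h (x n)| ^+ 2) s /\
    A%:C * `|h| ^+ 2 <= s <= B%:C * `|h| ^+ 2].

Definition analysis (x : nat -> H) : H -> nat -> C := fun h n => dot h (x n).

(* Elements of l^2(J) are represented by functions on [nat], whose values
   outside [J] are irrelevant. *)
Definition l2 (J : set nat) : set (nat -> C) :=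
  [set c : nat -> C | exists s : C, has_sum J (fun n => `|c n| ^+ 2) s].

(* [<T h, c> = <h, T' c>], where the left-hand inner product is that of
   l^2(J). *)
Definition is_adjoint (J : set nat) (T : H -> nat -> C) (T' : (nat -> C) -> H) :=
  forall h c, l2 J c -> has_sum J (fun n => T h n * (c n)^*) (dot h (T' c)).

(* Determined on l^2(J) only. *)
Definition adjoint (J : set nat) (T : H -> nat -> C) : (nat -> C) -> H :=
  get (is_adjoint J T).

Definition frame_op (J : set nat) (x : nat -> H) : H -> H :=
  adjoint J (analysis x) \o analysis x.

Definition canonical_dual (J : set nat) (x : nat -> H) : nat -> H :=
  fun n => op_inv (frame_op J x) (x n).

Definition is_dual_frame (J : set nat) (x v : nat -> H) :=
  is_frame J v /\ forall h, has_sum J (fun n => dot h (x n) *: v n) h.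

Definition minimal_redundancy (J E : set nat) (x : nat -> H) :=
  closure (lin_span [set x n | n in J `\` E]) = setT.

Section FiniteSubfamily.
Variables (k : nat) (idx : 'I_k -> nat).

Definition analysis_fin (x : nat -> H) (h : H) : 'rV[C]_k :=
  \row_i dot h (x (idx i)).

Definition synthesis_fin (y : nat -> H) (c : 'rV[C]_k) : H :=
  \sum_(i < k) c 0 i *: y (idx i).

Lemma synthesis_fin_adjoint (y : nat -> H) (h : H) (c : 'rV[C]_k) :
  \sum_(i < k) analysis_fin y h 0 i * (c 0 i)^* = dot h (synthesis_fin y c).
Proof.
rewrite /synthesis_fin linear_sumr /=; apply: eq_bigr => i _.
by rewrite mxE linearZr_LR mulrC.
Qed.

(* [V_E^* U_E]; [synthesis_fin y] is the adjoint of [analysis_fin y]. *)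
Definition VU (x y : nat -> H) : H -> H :=
  synthesis_fin y \o analysis_fin x.

Lemma VUE (x y : nat -> H) (h : H) :
  VU x y h = \sum_(i < k) dot h (x (idx i)) *: y (idx i).
Proof. by rewrite /VU /synthesis_fin /=; under eq_bigr do rewrite mxE. Qed.

Definition coef_system (x y : nat -> H) (n : nat) (a : 'rV[C]_k) :=
  forall i : 'I_k,
    \sum_(j < k) dot (y (idx j)) (x (idx i)) * a 0 j - a 0 i
      = dot (y n) (x (idx i)).

End FiniteSubfamily.
End InnerProduct.
End Hilbert.
End Frames.
Arguments finite_dim {R} H.
Arguments separable {R} H.
Arguments is_index_set {R} H J.

(* Main.v *)
(* Let S be the frame operator and T = I - V_E^* U_E. Since h = sum_J <h, x_n> y_n,
   T h is the same sum restricted to J \ E. If T h = 0, then pairing h with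
   S T h = sum_(J \ E) <h, x_n> x_n gives sum_(J \ E) |<h, x_n>|^2 = 0, so h is
   orthogonal to a dense subspace. As T is a finite-rank perturbation of the
   identity, the matrix of the linear system is injective too, hence invertible,
   and solving the system yields T^-1 explicitly, with v_n = T^-1 y_n off E.
   Applying T^-1 to T h = sum_(J \ E) <h, x_n> y_n shows that v is dual to x;
   its frame bounds follow by duality between analysis and synthesis. *)

Require Import Defs.
From HB Require Import structures.
From mathcomp Require Import all_boot all_order all_algebra complex.
From mathcomp Require Import all_classical all_reals all_analysis.
From mathcomp Require Import ring lra.

Set Implicit Arguments.
Unset Strict Implicit.
Unset Printing Implicit Defensive.

Import Order.TTheory GRing.Theory Num.Theory.
Import numFieldNormedType.Exports.

Local Open Scope classical_set_scope.
Local Open Scope complex_scope.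
Local Open Scope ring_scope.

(** * Real-valued norms and limits of real sequences in [C] *)

Section RealNorm.
Context {R : realType}.
Local Notation C := R[i].

(** The norm of a [normedModType C] takes its values in [C]; its real part carries the same
    information and lives in the totally ordered field [R], where [lra] and [nra] apply. *)
Definition nm {V : normedModType C} (v : V) : R := complex.Re `|v|.

Section Generic.
Context {V : normedModType C}.
Implicit Types (v w : V) (a : C).

Lemma normE v : `|v| = (nm v)%:C.
Proof. by rewrite RRe_real. Qed.

Lemma nm_ge0 v : 0 <= nm v.
Proof. rewrite -lecR -normE; exact: normr_ge0. Qed.

Lemma nm0 : nm (0 : V) = 0.
Proof. by apply: complexI; rewrite -normE normr0. Qed.

Lemma nm_eq0 v : (nm v == 0) = (v == 0).
Proof.
by rewrite -[RHS]normr_eq0 normE -(inj_eq (@complexI R)).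
Qed.

Lemma nmZ a v : nm (a *: v) = nm a * nm v.
Proof. by apply: complexI; rewrite rmorphM/= -!normE normrZ. Qed.

Lemma nmD v w : nm (v + w) <= nm v + nm w.
Proof. by rewrite -lecR rmorphD/= -!normE ler_normD. Qed.

Lemma nmB v w : nm (v - w) <= nm v + nm w.
Proof. by rewrite -lecR rmorphD/= -!normE ler_normB. Qed.

Lemma nm_sum (I : Type) (r : seq I) (P : pred I) (f : I -> V) :
  nm (\sum_(i <- r | P i) f i) <= \sum_(i <- r | P i) nm (f i).
Proof.
apply: (big_ind2 (fun v c => nm v <= c)) => //; first by rewrite nm0.
by move=> v a w b va wb; rewrite (le_trans (nmD _ _))// lerD.
Qed.

Lemma cvg_nm (u : nat -> V) l : u @ \oo --> l -> (fun n => nm (u n)) @ \oo --> nm l.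
Proof.
move=> ul; apply/cvgrPdist_lt => e e0.
have e0' : 0 < e%:C :> C by rewrite ltcR.
move/cvgrPdist_lt : ul => /(_ _ e0'); apply: filterS => n.
rewrite normE ltcR => /(le_lt_trans _); apply.
have := nmD (l - u n) (u n); have := nmB l (l - u n).
by rewrite subrK opprB addrC subrK => *; rewrite ler_norml; apply/andP; split; lra.
Qed.

Lemma nm_le_cvg (u : nat -> V) l (M : R) :
  u @ \oo --> l -> (forall n, nm (u n) <= M) -> nm l <= M.
Proof.
move=> /cvg_nm ul uM.
rewrite -(cvg_lim _ ul)//; apply: limr_le; last exact: nearW.
by apply/cvg_ex; exists (nm l).
Qed.

End Generic.

Lemma nmM (a b : C) : nm (a * b) = nm a * nm b.
Proof. exact: (nmZ a b). Qed.

Lemma nm_conj (a : C) : nm (a^*) = nm a.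
Proof. by apply: complexI; rewrite -!normE; exact: norm_conjC. Qed.

Lemma sqr_nm (a : C) : (nm a ^+ 2)%:C = a * a^*.
Proof. by rewrite rmorphXn/= -normE normCK. Qed.

Lemma Re_le_nm (a : C) : `|complex.Re a| <= nm a.
Proof. by rewrite -lecR -normE normc_ge_Re. Qed.

Lemma nm_real (a : R) : nm (a%:C) = `|a|.
Proof.
by rewrite /nm normc_def /= expr0n /= addr0 sqrtr_sqr.
Qed.

Lemma cvg_Re (u : nat -> C) l :
  u @ \oo --> l -> (fun n => complex.Re (u n)) @ \oo --> complex.Re l.
Proof.
move=> ul; apply/cvgrPdist_lt => e e0.
have e0' : 0 < e%:C :> C by rewrite ltcR.
move/cvgrPdist_lt : ul => /(_ _ e0'); apply: filterS => n.
rewrite normE ltcR => /(le_lt_trans _); apply.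
by rewrite -raddfB; exact: Re_le_nm.
Qed.

Lemma cvg_realC (u : nat -> R) (l : R) :
  u @ \oo --> l -> (fun n => (u n)%:C : C) @ \oo --> (l%:C : C).
Proof.
move=> ul; apply/cvgrPdist_lt => e e0.
(* In the order of [C] a positive element is real, so the tolerance [e] is the image of a real
   number. *)
have eE : e = (complex.Re e)%:C by rewrite RRe_real// gtr0_real.
move: e0; rewrite eE ltcR => e0.
move/cvgrPdist_lt : ul => /(_ _ e0); apply: filterS => n.
by rewrite normE ltcR -rmorphB nm_real.
Qed.

Lemma cvg_realCP (u : nat -> R) (s : C) :
  (fun n => (u n)%:C : C) @ \oo --> s ->
  u @ \oo --> complex.Re s /\ s = (complex.Re s)%:C.
Proof.
move=> us; have us' := cvg_Re us; split=> //.
exact: (cvg_unique _ us (cvg_realC us')).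
Qed.

End RealNorm.

(** * Cauchy-Schwarz and continuity of the inner product *)

Section Inner.
Context {R : realType}.
Local Notation C := R[i].
Context {H : completeNormedModType C}.
Variable dot : {dot H for @Num.conj C}.
Hypothesis dot_norm : forall h, dot h h = `|h| ^+ 2.
Implicit Types (a b h g : H).

Lemma dotC a b : dot a b = (dot b a)^*.
Proof. by rewrite hermitian_subproof expr0 mul1r. Qed.

Lemma dot_nm h : dot h h = (nm h ^+ 2)%:C.
Proof. by rewrite dot_norm normE rmorphXn. Qed.

Lemma dotZr c a b : dot a (c *: b) = c^* * dot a b.
Proof. exact: linearZr_LR. Qed.

Lemma dotZl c a b : dot (c *: a) b = c * dot a b.
Proof. exact: linearZl_LR. Qed.

Lemma dotBl a b g : dot (a - b) g = dot a g - dot b g.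
Proof. exact: linearBl. Qed.

Lemma dotBr g a b : dot g (a - b) = dot g a - dot g b.
Proof. exact: linearBr. Qed.

(** The square of the norm of [dot b b *: a - dot a b *: b] equals [nm b ^+ 2] times the defect in
    the squared inequality. This form of the projection argument needs no division. *)
Lemma CauchySchwarz a b : nm (dot a b) <= nm a * nm b.
Proof.
have [->|b0] := eqVneq b 0; first by rewrite linear0r !nm0 mulr0.
have b2 : 0 < nm b ^+ 2 by rewrite exprn_gt0// lt_neqAle nm_ge0 eq_sym nm_eq0 b0.
have := sqr_ge0 (nm (dot b b *: a - dot a b *: b)).
have -> : nm (dot b b *: a - dot a b *: b) ^+ 2 =
    nm b ^+ 2 * (nm b ^+ 2 * nm a ^+ 2 - nm (dot a b) ^+ 2).
  apply: complexI; rewrite -dot_nm !rmorphM/= rmorphB/= rmorphM/= -!dot_nm sqr_nm.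
  rewrite !(dotBl, dotBr) !dotZl !dotZr -(dotC b a) -(dotC b b).
  by have := dot_nm b; rewrite rmorphXn expr2 /= => <-; ring.
rewrite pmulr_rge0// subr_ge0 mulrC -exprMn ler_pXn2r ?nnegrE ?mulr_ge0 ?nm_ge0//.
Qed.

Lemma cvg_dotl (u : nat -> H) l g :
  u @ \oo --> l -> (fun n => dot (u n) g) @ \oo --> dot l g.
Proof.
move=> ul; apply/cvgrPdist_le => e e0.
have eE : e = (complex.Re e)%:C by rewrite RRe_real// gtr0_real.
rewrite eE ltcR in e0.
(* The [+ 1] keeps the divisor positive when [g] is zero. *)
have e0' : 0 < (complex.Re e / (nm g + 1))%:C :> C.
  by rewrite ltcR divr_gt0// ltr_wpDl// nm_ge0.
move/cvgrPdist_le : ul => /(_ _ e0'); apply: filterS => n.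
rewrite eE -dotBl normE normE !lecR /= => ul.
rewrite (le_trans (CauchySchwarz _ _))//.
move: ul; rewrite ler_pdivlMr ?ltr_wpDl ?nm_ge0//.
by have := nm_ge0 (l - u n); nra.
Qed.

Lemma cvg_dotr (u : nat -> H) l g :
  u @ \oo --> l -> (fun n => dot g (u n)) @ \oo --> dot g l.
Proof.
move=> /cvg_dotl => /(_ g) ul; apply/cvgrPdist_le => e e0.
move/cvgrPdist_le : ul => /(_ _ e0); apply: filterS => n.
by rewrite (dotC g l) (dotC g (u n)) -rmorphB norm_conjC.
Qed.

Lemma dot_inj a b : (forall g, dot g a = dot g b) -> a = b.
Proof.
move=> /(_ (a - b)) ab; apply/eqP; rewrite -subr_eq0 -nm_eq0 -sqrf_eq0.
by rewrite -(inj_eq (@complexI R)) -dot_nm dotBr ab subrr.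
Qed.

End Inner.

(** * Duality between Bessel bounds and synthesis bounds for finite sums *)

Section FiniteDuality.
Context {R : realType}.
Local Notation C := R[i].
Context {H : completeNormedModType C}.
Variable dot : {dot H for @Num.conj C}.
Hypothesis dot_norm : forall h, dot h h = `|h| ^+ 2.
Variables (I : Type) (r : seq I) (P : pred I).
Implicit Types (x : I -> H) (c d : I -> C).

(* AM-GM: [2 t |c| |d| <= t^2 |c|^2 + |d|^2] *)
Lemma ler_nm_sumM c d (t : R) : 0 <= t ->
  2 * t * nm (\sum_(i <- r | P i) c i * d i) <=
  t ^+ 2 * (\sum_(i <- r | P i) nm (c i) ^+ 2) + \sum_(i <- r | P i) nm (d i) ^+ 2.
Proof.
move=> t0.
rewrite (le_trans (ler_wpM2l _ (nm_sum _ _ _)))//; first by rewrite mulr_ge0.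
rewrite !mulr_sumr -big_split/=; apply: ler_sum => i _.
by rewrite nmM; have := sqr_ge0 (t * nm (c i) - nm (d i)); nra.
Qed.

Lemma dot_suml c x g :
  dot (\sum_(i <- r | P i) c i *: x i) g = \sum_(i <- r | P i) c i * dot (x i) g.
Proof.
have dotD : {morph dot^~ g : a b / a + b} by move=> a b; exact: linearDl.
have dot0 : dot 0 g = 0 by exact: linear0l.
by rewrite (big_morph _ dotD dot0); apply: eq_bigr => i _; exact: dotZl.
Qed.

(** Pairing the sum [z] with itself and applying AM-GM with [t = M] gives
    [2 M |z|^2 <= M^2 sum |c_i|^2 + M |z|^2]; then [M] cancels. *)
Lemma synthesis_le_of_bessel x c (M : R) : 0 < M ->
  (forall z, \sum_(i <- r | P i) nm (dot z (x i)) ^+ 2 <= M * nm z ^+ 2) ->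
  nm (\sum_(i <- r | P i) c i *: x i) ^+ 2 <= M * \sum_(i <- r | P i) nm (c i) ^+ 2.
Proof.
move=> M0 xM; set z := \sum_(i <- r | P i) _.
have := ler_nm_sumM c (fun i => dot (x i) z) (ltW M0).
rewrite -dot_suml -/z (dot_nm dot_norm) nm_real ger0_norm ?sqr_ge0//.
under [X in _ + X]eq_bigr do rewrite (dotC dot) nm_conj.
have := xM z; set S := \sum_(i <- r | P i) _; set Q := \sum_(i <- r | P i) _.
move=> SM h; rewrite -(ler_pM2l M0); nra.
Qed.

(** With [c_i = <h, x_i>] the synthesized vector [z] satisfies [<z, h> = S], so Cauchy-Schwarz gives
    [S^2 <= M S |h|^2]; a nonzero [S] cancels. *)
Lemma bessel_of_synthesis_le x (M : R) : 0 < M ->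
  (forall c, nm (\sum_(i <- r | P i) c i *: x i) ^+ 2 <=
             M * \sum_(i <- r | P i) nm (c i) ^+ 2) ->
  forall h, \sum_(i <- r | P i) nm (dot h (x i)) ^+ 2 <= M * nm h ^+ 2.
Proof.
move=> M0 xM h; set S := \sum_(i <- r | P i) _.
have S0 : 0 <= S by apply: sumr_ge0 => i _; exact: sqr_ge0.
have := xM (fun i => dot h (x i)); rewrite -/S; set z := \sum_(i <- r | P i) _ => zS.
have zh : dot z h = S%:C.
  rewrite dot_suml rmorph_sum/=; apply: eq_bigr => i _.
  by rewrite sqr_nm (dotC dot (x i)).
have := CauchySchwarz dot_norm z h; rewrite zh nm_real ger0_norm// => Szh.
have {}Szh : S ^+ 2 <= S * (M * nm h ^+ 2).
  rewrite (@le_trans _ _ ((nm z * nm h) ^+ 2))//.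
    by rewrite ler_pXn2r ?nnegrE ?mulr_ge0 ?nm_ge0.
  by rewrite exprMn mulrA (mulrC S) ler_wpM2r ?sqr_ge0.
have [->|Sn0] := eqVneq S 0; first by rewrite mulr_ge0 ?sqr_ge0// ltW.
by rewrite -(@ler_pM2l _ S) ?lt_neqAle 1?eq_sym ?Sn0.
Qed.

End FiniteDuality.

(** * Sums over an index set: algebra, finite support, nonnegative terms *)

Section HasSum.
Context {R : realType}.
Local Notation C := R[i].
Variable J : set nat.

Section Generic.
Context {V : normedModType C}.
Implicit Types (f g : nat -> V) (s t : V).

Lemma eq_has_sum f g s : (forall n, J n -> f n = g n) ->
  has_sum J f s -> has_sum J g s.
Proof.
move=> fg; rewrite /has_sum; apply: cvg_trans; apply: near_eq_cvg; apply: nearW => N.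
by apply: eq_bigr => n; rewrite inE => /fg.
Qed.

Lemma has_sum_unique f s t : has_sum J f s -> has_sum J f t -> s = t.
Proof. exact: cvg_unique. Qed.

Lemma has_sumB f g s t : has_sum J f s -> has_sum J g t ->
  has_sum J (fun n => f n - g n) (s - t).
Proof.
move=> fs gt; rewrite /has_sum.
under eq_fun do rewrite sumrB.
exact: cvgB.
Qed.

Lemma has_sumD f g s t : has_sum J f s -> has_sum J g t ->
  has_sum J (fun n => f n + g n) (s + t).
Proof.
move=> fs gt; rewrite /has_sum.
under eq_fun do rewrite big_split.
exact: cvgD.
Qed.

Lemma has_sumZ (a : C) f s : has_sum J f s ->
  has_sum J (fun n => a *: f n) (a *: s).
Proof.
move=> fs; rewrite /has_sum.
under eq_fun do rewrite -scaler_sumr.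
exact: cvgZl_tmp.
Qed.

Lemma has_sum_fin (k : nat) (idx : 'I_k -> nat) f : injective idx ->
  range idx `<=` J ->
  has_sum J (fun n => if n \in range idx then f n else 0) (\sum_(i < k) f (idx i)).
Proof.
move=> idx_inj EJ.
(* One past the largest index: from [N0] on, the range [0 <= n < N] contains every [idx i], and the
   partial sums are constant. *)
pose N0 := (\max_(i < k) idx i).+1.
have : (fun _ : nat => \sum_(i < k) f (idx i)) @ \oo --> \sum_(i < k) f (idx i).
  exact: cvg_cst.
apply: cvg_trans; apply: near_eq_cvg; exists N0 => // N /= N0N.
rewrite [RHS]big_mkcond/=.
have idxN i : (idx i < N)%N.
  by apply: leq_trans N0N; rewrite ltnS; exact: leq_bigmax.
(* Each [f (idx i)] is spread over [n] by an indicator; after exchanging the sums, injectivity of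
   [idx] leaves at most one nonzero term for each [n]. *)
transitivity (\sum_(i < k) \sum_(0 <= n < N) (if n == idx i then f n else 0)).
  by apply: eq_bigr => i _; rewrite -big_mkcond/= big_nat1_eq/= idxN.
rewrite exchange_big/=; apply: eq_bigr => n _.
case: ifPn => [nJ|nJ]; last first.
  rewrite big1// => i _; case: eqP => // ni.
  by move: nJ; rewrite notin_setE => -[]; apply: EJ; exists i.
case: ifPn => [|nE]; last first.
  rewrite big1// => i _; case: eqP => // ni.
  by move: nE; rewrite notin_setE => -[]; exists i.
rewrite inE => -[i _ <-]; rewrite (bigD1 i)//= eqxx big1 ?addr0// => j ji.
by case: eqP => // /idx_inj ij; rewrite ij eqxx in ji.
Qed.

End Generic.

(** Only additivity and sequential continuity are asked of [T], so that the conjugate-linear map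
    [dot g] is covered too. *)
Lemma has_sum_map (V W : normedModType C) (T : V -> W) (f : nat -> V) s :
  {morph T : a b / a + b} -> T 0 = 0 ->
  (forall (u : nat -> V) l, u @ \oo --> l -> (T \o u) @ \oo --> T l) ->
  has_sum J f s -> has_sum J (T \o f) (T s).
Proof.
move=> TD T0 Tc /Tc; rewrite /has_sum /comp.
under eq_fun do rewrite (big_morph T TD T0).
by [].
Qed.

Lemma has_sum_real (f : nat -> R) (s : C) :
  has_sum J (fun n => (f n)%:C : C) s ->
  (fun N => \sum_(0 <= n < N | n \in J) f n) @ \oo --> complex.Re s /\
  s = (complex.Re s)%:C.
Proof.
by move=> fs; apply: cvg_realCP; under eq_fun do rewrite rmorph_sum.
Qed.

Lemma cvg_has_sum_real (f : nat -> R) (s : R) :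
  (fun N => \sum_(0 <= n < N | n \in J) f n) @ \oo --> s ->
  has_sum J (fun n => (f n)%:C : C) (s%:C : C).
Proof.
by move=> /cvg_realC; rewrite /has_sum; under eq_fun do rewrite rmorph_sum.
Qed.

Section Nonneg.
Variable f : nat -> R.
Hypothesis f0 : forall n, 0 <= f n.

Lemma nondecreasing_psum :
  nondecreasing_seq (fun N => \sum_(0 <= n < N | n \in J) f n).
Proof.
apply/nondecreasing_seqP => N; rewrite big_mkcond [leRHS]big_mkcond/=.
by rewrite big_nat_recr//= lerDl; case: ifP.
Qed.

Lemma psum_le (s : R) (N : nat) :
  (fun N => \sum_(0 <= n < N | n \in J) f n) @ \oo --> s ->
  \sum_(0 <= n < N | n \in J) f n <= s.
Proof.
move=> fs; rewrite -(cvg_lim _ fs)//; apply: nondecreasing_cvgn_le => //.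
  exact: nondecreasing_psum.
by apply/cvg_ex; exists s.
Qed.

Lemma has_sum_bounded (M : R) :
  (forall N, \sum_(0 <= n < N | n \in J) f n <= M) ->
  exists s : R, s <= M /\ has_sum J (fun n => (f n)%:C : C) (s%:C : C).
Proof.
move=> fM; pose u N := \sum_(0 <= n < N | n \in J) f n.
have cu : cvgn u.
  apply: nondecreasing_is_cvgn; first exact: nondecreasing_psum.
  by exists M => _ [N _ <-]; exact: fM.
exists (limn u); split; last exact: cvg_has_sum_real.
by apply: limr_le => //; exact: nearW.
Qed.

Lemma has_sum_eq0 : has_sum J (fun n => (f n)%:C : C) 0 ->
  forall n, J n -> f n = 0.
Proof.
move=> /has_sum_real[f0' _] n Jn; apply/eqP; rewrite eq_le f0 andbT.
rewrite (le_trans _ (psum_le n.+1 f0'))// big_mkcond/= big_nat_recr//=.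
rewrite mem_set// lerDr; apply: sumr_ge0 => i _; by case: ifP.
Qed.

End Nonneg.
End HasSum.

(** * Bounded operators and invertibility of coercive ones *)

Section BoundedOp.
Context {R : realType}.
Local Notation C := R[i].
Context {H : completeNormedModType C}.
Implicit Types (T : H -> H) (h g : H).

Lemma bounded_opP T : linear T ->
  (exists M : R, forall h, nm (T h) <= M * nm h) -> bounded_op T.
Proof.
move=> Tl [M TM]; split=> //; exists M => h.
by rewrite !normE -rmorphM lecR.
Qed.

Lemma bounded_op_nm T : bounded_op T ->
  exists2 M : R, 0 < M & forall h, nm (T h) <= M * nm h.
Proof.
move=> [_ [M TM]]; exists (`|M| + 1) => [|h]; first by rewrite ltr_wpDl.
have := TM h; rewrite !normE -rmorphM lecR => /le_trans; apply.
by rewrite ler_wpM2r ?nm_ge0// (le_trans (ler_norm _))// lerDl.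
Qed.

Section Theory.
Variable T : H -> H.
Hypothesis bT : bounded_op T.

Lemma bounded_opD : {morph T : a b / a + b}.
Proof. by case: bT => Tl _ a b; have := Tl 1 a b; rewrite !scale1r. Qed.

Lemma bounded_op0 : T 0 = 0.
Proof. by apply: (addrI (T 0)); rewrite -bounded_opD !addr0. Qed.

Lemma bounded_opZ (c : C) h : T (c *: h) = c *: T h.
Proof. by case: bT => Tl _; have := Tl c h 0; rewrite bounded_op0 !addr0. Qed.

Lemma bounded_opB h g : T (h - g) = T h - T g.
Proof. by rewrite bounded_opD -scaleN1r bounded_opZ scaleN1r. Qed.

Lemma bounded_op_sum (I : Type) (r : seq I) (P : pred I) (f : I -> H) :
  T (\sum_(i <- r | P i) f i) = \sum_(i <- r | P i) T (f i).
Proof. exact: (big_morph T bounded_opD bounded_op0). Qed.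

Lemma bounded_op_cvg (u : nat -> H) l : u @ \oo --> l -> (T \o u) @ \oo --> T l.
Proof.
move=> ul; have [M M0 TM] := bounded_op_nm bT.
apply/cvgrPdist_lt => e e0.
have eE : e = (complex.Re e)%:C by rewrite RRe_real// gtr0_real.
rewrite eE ltcR in e0.
have e0' : 0 < (complex.Re e / M)%:C :> C by rewrite ltcR divr_gt0.
move/cvgrPdist_lt : ul => /(_ _ e0'); apply: filterS => n.
rewrite eE /= -bounded_opB !normE !ltcR /= ltr_pdivlMr// mulrC.
exact: le_lt_trans.
Qed.

Lemma has_sum_bounded_op (J : set nat) (f : nat -> H) s :
  has_sum J f s -> has_sum J (T \o f) (T s).
Proof.
apply: has_sum_map; [exact: bounded_opD|exact: bounded_op0|exact: bounded_op_cvg].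
Qed.

End Theory.

Lemma bounded_op_id : bounded_op (@id H).
Proof. by apply: bounded_opP => //; exists 1 => h; rewrite mul1r. Qed.

Lemma bounded_op_sub T1 T2 : bounded_op T1 -> bounded_op T2 ->
  bounded_op (fun h => T1 h - T2 h).
Proof.
move=> b1 b2; apply: bounded_opP => [c u v|].
  rewrite (bounded_opD b1) (bounded_opD b2) (bounded_opZ b1) (bounded_opZ b2).
  by rewrite scalerBr opprD addrACA.
have [M1 _ T1M] := bounded_op_nm b1; have [M2 _ T2M] := bounded_op_nm b2.
exists (M1 + M2) => h; rewrite (le_trans (nmB _ _))// mulrDl.
by rewrite lerD.
Qed.

Lemma bounded_op_add T1 T2 : bounded_op T1 -> bounded_op T2 ->
  bounded_op (fun h => T1 h + T2 h).
Proof.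
move=> b1 b2; apply: bounded_opP => [c u v|].
  rewrite (bounded_opD b1) (bounded_opD b2) (bounded_opZ b1) (bounded_opZ b2).
  by rewrite scalerDr addrACA.
have [M1 _ T1M] := bounded_op_nm b1; have [M2 _ T2M] := bounded_op_nm b2.
exists (M1 + M2) => h; rewrite (le_trans (nmD _ _))// mulrDl.
by rewrite lerD.
Qed.

Lemma bounded_op_bigsum (I : Type) (r : seq I) (T : I -> H -> H) :
  (forall i, bounded_op (T i)) -> bounded_op (fun h => \sum_(i <- r) T i h).
Proof.
move=> bT; elim: r => [|i r IH].
  under eq_fun do rewrite big_nil.
  apply: bounded_opP => [c u v|]; first by rewrite scaler0 addr0.
  by exists 1 => h; rewrite nm0 mul1r nm_ge0.
under eq_fun do rewrite big_cons.
exact: bounded_op_add.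
Qed.

Lemma bounded_op_comp T1 T2 : bounded_op T1 -> bounded_op T2 ->
  bounded_op (T1 \o T2).
Proof.
move=> b1 b2; apply: bounded_opP => [c u v|].
  by rewrite /= (bounded_opD b2) (bounded_opZ b2) (bounded_opD b1) (bounded_opZ b1).
have [M1 M10 T1M] := bounded_op_nm b1; have [M2 _ T2M] := bounded_op_nm b2.
by exists (M1 * M2) => h; rewrite (le_trans (T1M _))// -mulrA ler_pM2l.
Qed.

Lemma op_invP T : invertible T -> is_inverse T (op_inv T).
Proof. by move=> iT; rewrite /op_inv; exact: getPex. Qed.

(** Blocks of [u] are bounded by blocks of [a], so the Cauchy criterion transfers and completeness
    of [H] concludes. *)
Lemma cvg_series_dominated (u : nat -> H) (a : nat -> R) :
  (forall n, nm (u n) <= a n) -> cvgn (series a) -> cvgn (series u).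
Proof.
move=> ua /cauchy_cvgP/cauchy_seriesP ca.
apply/cauchy_cvgP/cauchy_seriesP => e e0.
have eE : e = (complex.Re e)%:C by rewrite RRe_real// gtr0_real.
rewrite eE ltcR in e0; apply: filterS (ca _ e0) => n.
rewrite [e]eE normE ltcR; apply: le_lt_trans.
rewrite (le_trans (nm_sum _ _ _))// (le_trans _ (ler_norm _))//.
by apply: ler_sum => i _.
Qed.

Section Coercive.
Variable dot : {dot H for @Num.conj C}.
Hypothesis dot_norm : forall h, dot h h = `|h| ^+ 2.

Lemma sqr_nm_subZ h g (t : R) :
  nm (h - t%:C *: g) ^+ 2 =
  nm h ^+ 2 - 2 * t * complex.Re (dot h g) + t ^+ 2 * nm g ^+ 2.
Proof.
have := dot_nm dot_norm (h - t%:C *: g).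
rewrite !(dotBl, dotBr, dotZl, dotZr) (dotC dot g h) !(dot_nm dot_norm).
move=> /(congr1 (@complex.Re R)) /= <-.
case: (dot h g) => p q /=; ring.
Qed.

(** A form of the Lax-Milgram theorem. Coercivity and Cauchy-Schwarz give [A |h| <= |T h|], hence
    injectivity and the bound [A^-1] for the inverse; the remaining point is surjectivity. *)
Lemma bounded_coercive_invertible T (A B : R) : 0 < A -> 0 < B -> linear T ->
  (forall h, nm (T h) <= B * nm h) ->
  (forall h, A * nm h ^+ 2 <= complex.Re (dot h (T h))) ->
  invertible T.
Proof.
move=> A0 B0 Tl TB TA.
have bT : bounded_op T by apply: bounded_opP => //; exists B.
have Tge h : A * nm h <= nm (T h).
  have [->|h0] := eqVneq (nm h) 0; first by rewrite mulr0 nm_ge0.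
  have hp : 0 < nm h by rewrite lt_neqAle eq_sym h0 nm_ge0.
  rewrite -(ler_pM2l hp) (le_trans _ (CauchySchwarz dot_norm _ _))//.
  rewrite (le_trans _ (Re_le_nm _))// (le_trans _ (ler_norm _))//.
  by rewrite (le_trans _ (TA h))// mulrCA expr2.
have Tinj : injective T.
  move=> u v uv; apply/eqP; rewrite -subr_eq0 -nm_eq0 eq_le nm_ge0 andbT.
  by have := Tge (u - v); rewrite (bounded_opB bT) uv subrr nm0 pmulr_rle0.
(* The Neumann series of [t T], where [I - t T] is a contraction. *)
have Tsurj z : exists h, T h = z.
  (* [D] exceeds both [A] and [B], so it bounds [T] and makes [c = A^2 / D^2] less than 1. The value
     [t = A / D^2] minimizes [1 - 2 t A + t^2 D^2], with minimum [1 - c]. *)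
  pose D := A + B; have D0 : 0 < D by rewrite addr_gt0.
  pose t := A / D ^+ 2; have t0 : 0 < t by rewrite divr_gt0 ?exprn_gt0.
  pose c := A * t.
  have c0 : 0 < c by rewrite mulr_gt0.
  have tD : t * D ^+ 2 = A by rewrite divfK// expf_neq0// gt_eqF.
  have c1 : c < 1.
    by rewrite /c /t mulrA ltr_pdivrMr ?exprn_gt0// mul1r /D; nra.
  (* [q ^+ 2 >= 1 - c], so [q] is a contraction factor that avoids a square root. *)
  pose q : R := 1 - c / 2.
  have q0 : 0 < q by rewrite /q; lra.
  have q1 : q < 1 by rewrite /q; lra.
  pose F h := h - t%:C *: T h.
  have FM h : nm (F h) <= q * nm h.
    rewrite -(@ler_pXn2r _ 2) ?nnegrE ?mulr_ge0 ?nm_ge0 ?(ltW q0)//.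
    rewrite sqr_nm_subZ (exprMn _ q).
    have h2 := sqr_ge0 (nm h).
    have T2 : nm (T h) ^+ 2 <= D ^+ 2 * nm h ^+ 2.
      rewrite -exprMn ler_pXn2r ?nnegrE ?mulr_ge0 ?nm_ge0 ?(ltW D0)//.
      by rewrite (le_trans (TB h))// ler_wpM2r ?nm_ge0// /D lerDr ltW.
    have tT : t ^+ 2 * nm (T h) ^+ 2 <= c * nm h ^+ 2.
      rewrite (le_trans (ler_wpM2l (sqr_ge0 t) T2))// mulrA expr2 -(mulrA t) tD.
      by rewrite /c (mulrC A).
    have tA : c * nm h ^+ 2 <= t * complex.Re (dot h (T h)).
      by rewrite /c (mulrC A) -mulrA ler_pM2l.
    have q2 : (1 - c) * nm h ^+ 2 <= q ^+ 2 * nm h ^+ 2.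
      by rewrite ler_wpM2r// /q; nra.
    rewrite (le_trans _ q2)// mulrBl mul1r; move: tT tA; rewrite -(mulrA 2).
    set X := c * _; set Y := t * _; set Z := t ^+ 2 * _; set W := nm h ^+ 2.
    by move: X Y Z W => X Y Z W; lra.
  pose v k := iter k F z.
  have vM k : nm (v k) <= q ^+ k * nm z.
    elim: k => [|k IH]; first by rewrite expr0 mul1r.
    by rewrite (le_trans (FM _))// exprS -mulrA ler_pM2l.
  pose u k := t%:C *: v k.
  have cu : cvgn (series u).
    apply: (@cvg_series_dominated _ (geometric (t * nm z) q)).
      move=> n; rewrite nmZ nm_real gtr0_norm// /= -[leRHS]mulrA [nm z * _]mulrC.
      by rewrite ler_pM2l.
    by apply: is_cvg_geometric_series; rewrite gtr0_norm.
  (* The sum telescopes, since [t T (v k) = v k - v k.+1]. *)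
  have Tu N : T (series u N) = z - v N.
    elim: N => [|N IH]; first by rewrite /series/= big_geq// (bounded_op0 bT) subrr.
    rewrite /series/= big_nat_recr//= (bounded_opD bT) -/(series u N) IH.
    by rewrite /u (bounded_opZ bT) /F [in RHS]opprB [RHS]addrA addrAC.
  exists (limn (series u)).
  have Tul : (fun N => z - T (series u N)) @ \oo --> z - T (limn (series u)).
    by apply: cvgB; [exact: cvg_cst|exact: (bounded_op_cvg bT cu)].
  (* The terms [u N = t (z - T (series u N))] of a convergent series tend to 0, which forces [T] of
     the limit to be [z]. *)
  have : u @ \oo --> t%:C *: (z - T (limn (series u))).
    rewrite [X in X @ _](_ : u = fun N => t%:C *: (z - T (series u N))).
      exact: cvgZl_tmp.
    by apply/funext => N; rewrite Tu opprB addrC subrK.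
  move=> /(cvg_unique (@norm_hausdorff _ _) (cvg_series_cvg_0 cu)) /esym /eqP.
  have tC0 : 0 < t%:C :> C by rewrite ltcR.
  by rewrite scaler_eq0 gt_eqF//= subr_eq0 => /eqP <-.
have [T' TT'] := choice Tsurj.
exists T'; split=> //; last by move=> h; apply: Tinj; rewrite TT'.
apply: bounded_opP.
  move=> a b c; apply: Tinj.
  by rewrite TT' (bounded_opD bT) (bounded_opZ bT) !TT'.
by exists A^-1 => h; rewrite ler_pdivlMl// -{2}(TT' h).
Qed.

End Coercive.
End BoundedOp.

(** * Synthesis, the adjoint of the analysis operator, and the frame operator *)

Section FrameOperator.
Context {R : realType}.
Local Notation C := R[i].
Context {H : completeNormedModType C}.
Variable dot : {dot H for @Num.conj C}.
Hypothesis dot_norm : forall h, dot h h = `|h| ^+ 2.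
Variables (J : set nat) (x : nat -> H).

(** The upper bound is put on partial sums, so that it can be used and proved with finite sums
    before any convergence is known. *)
Definition bessel (B : R) := forall h N,
  \sum_(0 <= n < N | n \in J) nm (dot h (x n)) ^+ 2 <= B * nm h ^+ 2.

Lemma has_sum_dotr g (f : nat -> H) s :
  has_sum J f s -> has_sum J (fun n => dot g (f n)) (dot g s).
Proof.
apply: (has_sum_map (T := dot g)) => [a b||u l].
- exact: linearDr.
- exact: linear0r.
- exact: (cvg_dotr dot_norm).
Qed.

Lemma has_sum_dotl g (f : nat -> H) s :
  has_sum J f s -> has_sum J (fun n => dot (f n) g) (dot s g).
Proof.
apply: (has_sum_map (T := dot^~ g)) => [a b||u l].
- exact: linearDl.
- exact: linear0l.
- exact: (cvg_dotl dot_norm).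
Qed.

Lemma sqr_normE (z : C) : `|z| ^+ 2 = (nm z ^+ 2)%:C.
Proof. by rewrite normE rmorphXn. Qed.

Lemma is_frameP : is_frame dot J x <-> exists A B : R, [/\ 0 < A, 0 < B &
  forall h, exists s : R,
    has_sum J (fun n => (nm (dot h (x n)) ^+ 2)%:C : C) (s%:C : C) /\
    A * nm h ^+ 2 <= s <= B * nm h ^+ 2].
Proof.
have sqE h : (fun n => `|dot h (x n)| ^+ 2) = (fun n => (nm (dot h (x n)) ^+ 2)%:C).
  by apply/funext => n; rewrite sqr_normE.
split=> -[A [B [A0 B0 AB]]]; exists A, B; split=> // h.
  have [s [hs]] := AB h; rewrite sqE in hs; have [_ sE] := has_sum_real hs.
  rewrite sE in hs *; rewrite normE -rmorphXn -!rmorphM !lecR => sAB.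
  by exists (complex.Re s).
have [s [hs sAB]] := AB h; exists s%:C; rewrite sqE; split=> //.
by rewrite normE -rmorphXn -!rmorphM !lecR.
Qed.

Lemma frame_bessel : is_frame dot J x -> exists2 B : R, 0 < B & bessel B.
Proof.
move=> /is_frameP[A [B [A0 B0 AB]]]; exists B => // h N.
have [s [/has_sum_real[hs _] /andP[_ sB]]] := AB h.
by apply: le_trans sB; apply: (psum_le _ _ hs) => n; exact: sqr_ge0.
Qed.

Section Synthesis.
Variable B : R.
Hypotheses (B0 : 0 < B) (xB : bessel B).

(** The free lower index [m] makes the estimate applicable to the blocks of the Cauchy criterion. *)
Lemma bessel_synthesis_le c m N :
  nm (\sum_(m <= n < N | n \in J) c n *: x n) ^+ 2 <=
  B * \sum_(m <= n < N | n \in J) nm (c n) ^+ 2.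
Proof.
apply: (synthesis_le_of_bessel dot_norm) => // h; apply: le_trans (xB h N).
have [mN|Nm] := leqP m N; last first.
  by rewrite big_geq ?(ltnW Nm)//; apply: sumr_ge0 => n _; exact: sqr_ge0.
rewrite (big_cat_nat (leq0n m) mN)/= lerDr.
by apply: sumr_ge0 => n _; exact: sqr_ge0.
Qed.

Lemma synthesis_cvg c : l2 J c -> exists z, has_sum J (fun n => c n *: x n) z.
Proof.
move=> [s cs].
pose u n := if n \in J then c n *: x n else 0.
pose v n : C := if n \in J then `|c n| ^+ 2 else 0.
have cv : cvgn (series v).
  apply/cvg_ex; exists s; move: cs; rewrite /has_sum.
  by under eq_fun do rewrite big_mkcond.
suff /cvg_ex[z uz] : cvgn (series u).
  exists z; rewrite /has_sum; under eq_fun do rewrite big_mkcond.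
  exact: uz.
apply/cauchy_cvgP/cauchy_seriesP => e e0.
have eE : e = (complex.Re e)%:C by rewrite RRe_real// gtr0_real.
rewrite eE ltcR in e0.
(* A block of squared coefficients below [e^2 / B] gives a block of the synthesis series of norm
   below [e]. *)
have e0' : 0 < (complex.Re e ^+ 2 / B)%:C :> C by rewrite ltcR divr_gt0// exprn_gt0.
move/cvg_cauchy/cauchy_seriesP : cv => /(_ _ e0'); apply: filterS => -[m N] /=.
rewrite /u /v -!big_mkcond/=; under eq_bigr do rewrite sqr_normE.
rewrite -rmorph_sum/= [e]eE !normE !ltcR nm_real ltr_pdivlMr// => cN.
rewrite -(@ltr_pXn2r _ 2) ?nnegrE ?nm_ge0 ?(ltW e0)//.
apply: le_lt_trans cN; rewrite mulrC (le_trans (bessel_synthesis_le _ _ _))//.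
by rewrite ler_pM2l// ler_norm.
Qed.

Lemma bessel_has_sum_le c z s : has_sum J (fun n => c n *: x n) z ->
  has_sum J (fun n => (nm (c n) ^+ 2)%:C : C) (s%:C : C) -> nm z ^+ 2 <= B * s.
Proof.
move=> cz /has_sum_real[/= cs _].
have s0 : 0 <= s.
  have := psum_le (fun n => sqr_ge0 (nm (c n))) 0%N cs.
  by rewrite big_geq.
rewrite -[B * s]sqr_sqrtr ?mulr_ge0 ?(ltW B0)//.
rewrite ler_pXn2r ?nnegrE ?nm_ge0 ?sqrtr_ge0//.
apply: (nm_le_cvg cz) => N.
rewrite -(@ler_pXn2r _ 2) ?nnegrE ?nm_ge0 ?sqrtr_ge0// sqr_sqrtr ?mulr_ge0 ?(ltW B0)//.
rewrite (le_trans (bessel_synthesis_le _ _ _))// ler_pM2l//.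
by apply: (psum_le _ _ cs) => n; exact: sqr_ge0.
Qed.

Lemma has_sum_synthesis g c z : has_sum J (fun n => c n *: x n) z ->
  has_sum J (fun n => dot g (x n) * (c n)^*) (dot g z).
Proof.
move=> /(has_sum_dotr (g := g)); apply: eq_has_sum => n _ /=.
by rewrite dotZr mulrC.
Qed.

(** Synthesis, extended by 0 outside [l2 J], is an adjoint, so [get] does not return junk. Any other
    adjoint has the same inner products on [l2 J], hence the same values there. *)
Lemma adjoint_synthesis c z : l2 J c -> has_sum J (fun n => c n *: x n) z ->
  adjoint dot J (analysis dot x) c = z.
Proof.
move=> c2 cz.
have adj : is_adjoint dot J (analysis dot x) (adjoint dot J (analysis dot x)).
  have /choice[T' T'P] : forall d, exists w, l2 J d -> has_sum J (fun n => d n *: x n) w.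
    move=> d; have [/synthesis_cvg[w dw]|d2] := pselect (l2 J d); first by exists w.
    by exists 0.
  rewrite /adjoint; apply: getPex; exists T' => g d /T'P; exact: has_sum_synthesis.
apply: (dot_inj dot_norm) => g; apply: has_sum_unique (adj g c c2) _.
exact: has_sum_synthesis.
Qed.

End Synthesis.

Hypothesis x_frame : is_frame dot J x.

Lemma frame_op_has_sum h :
  has_sum J (fun n => dot h (x n) *: x n) (frame_op dot J x h).
Proof.
have [B B0 xB] := frame_bessel x_frame.
have h2 : l2 J (analysis dot x h).
  by have [_ [_ [_ _ /(_ h)[s [hs _]]]]] := x_frame; exists s.
have [z hz] := synthesis_cvg B0 xB h2.
by rewrite /frame_op /= (adjoint_synthesis B0 xB h2 hz).
Qed.

(** The frame operator is coercive because [<h, S h>] is the sum of the [|<h, x_n>|^2], bounded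
    below by [A |h|^2]. *)
Lemma frame_op_invertible : invertible (frame_op dot J x).
Proof.
have [B B0 xB] := frame_bessel x_frame.
have /is_frameP[A [B' [A0 B'0 AB]]] := x_frame.
pose S := frame_op dot J x.
have BB' : 0 < B * B' by rewrite mulr_gt0.
(* The norm bound comes from [|S h|^2 <= B s <= B B' |h|^2], where [s] is the sum of the
   [|<h, x_n>|^2]. *)
apply: (@bounded_coercive_invertible _ _ _ dot_norm _ A (Num.sqrt (B * B'))) => //.
- by rewrite sqrtr_gt0.
- move=> a g h; apply: (has_sum_unique (@frame_op_has_sum (a *: g + h))).
  have := has_sumD (has_sumZ (a := a) (@frame_op_has_sum g)) (@frame_op_has_sum h).
  apply: eq_has_sum => n _.
  by rewrite scalerA -scalerDl -dotZl; congr (_ *: _); rewrite [RHS]linearDl.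
- move=> h; have [s [hs /andP[_ sB]]] := AB h.
  rewrite -(@ler_pXn2r _ 2) ?nnegrE ?mulr_ge0 ?nm_ge0 ?sqrtr_ge0//.
  have /le_trans := bessel_has_sum_le B0 xB (@frame_op_has_sum h) hs; apply.
  by rewrite exprMn sqr_sqrtr ?(ltW BB')// -mulrA ler_pM2l.
- move=> h; have [s [hs /andP[sA _]]] := AB h.
  rewrite (_ : dot h _ = s%:C)//.
  have hS := has_sum_dotr (g := h) (@frame_op_has_sum h).
  apply: (has_sum_unique hS); apply: eq_has_sum hs => n _.
  by rewrite dotZr sqr_nm mulrC.
Qed.

End FrameOperator.

(** * Erasing the indices in [E]: inversion of [I - V_E^* U_E] and the resulting dual frame *)

Section Erasure.
Context {R : realType}.
Local Notation C := R[i].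
Context {H : completeNormedModType C}.
Variable dot : {dot H for @Num.conj C}.
Hypothesis dot_norm : forall h, dot h h = `|h| ^+ 2.
Variables (J : set nat) (x y : nat -> H).
Hypothesis x_frame : is_frame dot J x.
Hypothesis y_def : forall n, J n -> y n = canonical_dual dot J x n.
Variables (k : nat) (idx : 'I_k -> nat) (E : set nat).
Hypothesis idx_inj : injective idx.
Hypothesis E_def : E = range idx.
Hypothesis EJ : E `<=` J.
Hypothesis E_mr : minimal_redundancy J E x.

Local Notation S := (frame_op dot J x).
Local Notation S' := (op_inv (frame_op dot J x)).
Local Notation T := (fun h => h - VU dot idx x y h).

Let inv_S : is_inverse S S'.
Proof. exact: op_invP (frame_op_invertible dot_norm x_frame). Qed.

Lemma has_sum_canonical_dual h : has_sum J (fun n => dot h (x n) *: y n) h.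
Proof.
have [_ bS' SK _] := inv_S.
have := has_sum_bounded_op bS' (frame_op_has_sum dot_norm x_frame (h := h)).
rewrite SK; apply: eq_has_sum => n Jn /=.
by rewrite (bounded_opZ bS') y_def.
Qed.

(** Terms in [E] are replaced by 0 instead of shrinking the index set, so that all sums stay indexed
    by [J]. *)
Lemma has_sum_erasure h :
  has_sum J (fun n => if n \in E then 0 else dot h (x n) *: y n) (T h).
Proof.
have fin : range idx `<=` J by rewrite -E_def.
have := has_sumB (@has_sum_canonical_dual h)
  (has_sum_fin (f := fun n => dot h (x n) *: y n) idx_inj fin).
rewrite -E_def VUE; apply: eq_has_sum => n _.
by case: ifP; rewrite ?subrr ?subr0.
Qed.

(** Otherwise some [z] in the span lies at distance less than [|h|] from [h]; as [<z, h> = 0], this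
    gives [|h|^2 = <h - z, h> < |h|^2]. *)
Lemma minimal_redundancy_orthogonal h :
  (forall n, (J `\` E) n -> dot h (x n) = 0) -> h = 0.
Proof.
move=> hx; apply/eqP; rewrite -nm_eq0; apply/negP => h0.
have hp : 0 < nm h by rewrite lt_neqAle eq_sym nm_ge0 andbT; exact/negP.
have : closure (lin_span [set x n | n in J `\` E]) h by rewrite E_mr.
have hC : 0 < (nm h)%:C :> C by rewrite ltcR.
move=> /(_ _ (nbhsx_ballx h _ hC))[g [[m [c [a [ax ->]]]]]].
set z := \sum_(i < m) _; rewrite -ball_normE /= normE ltcR => hz.
have zh : dot z h = 0.
  rewrite dot_suml big1// => i _; have [n /hx nh <-] := ax i.
  by rewrite (dotC dot) nh rmorph0 mulr0.
have := CauchySchwarz dot_norm (h - z) h.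
rewrite dotBl zh subr0 (dot_nm dot_norm) nm_real ger0_norm ?sqr_ge0//.
by rewrite expr2 ler_pM2r// leNgt hz.
Qed.

Lemma erasure_ker h : T h = 0 -> h = 0.
Proof.
move=> Th; apply: minimal_redundancy_orthogonal => n [Jn En].
have [bS bS' _ S'K] := inv_S.
have := has_sum_dotr dot_norm (g := h) (has_sum_bounded_op bS (@has_sum_erasure h)).
rewrite Th (bounded_op0 bS) linear0r => hs.
pose f n := if n \in E then 0 else nm (dot h (x n)) ^+ 2.
have f0 m : 0 <= f m by rewrite /f; case: ifP => // _; exact: sqr_ge0.
have fs : has_sum J (fun n => (f n)%:C : C) 0.
  apply: eq_has_sum hs => m Jm; rewrite /f /=; case: ifP => _.
    by rewrite (bounded_op0 bS) linear0r.
  by rewrite (bounded_opZ bS) y_def// /canonical_dual S'K dotZr sqr_nm mulrC.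
have := has_sum_eq0 f0 fs Jn; rewrite /f memNset//.
by move=> /eqP; rewrite sqrf_eq0 nm_eq0 => /eqP.
Qed.

(** The cross Gram matrix minus the identity, laid out so that a coefficient row multiplies it from
    the left. *)
Definition erasure_mx : 'M[C]_k :=
  \matrix_(j, i) (dot (y (idx j)) (x (idx i)) - (j == i)%:R).

Lemma erasure_mxE (a : 'rV[C]_k) i :
  (a *m erasure_mx) 0 i =
  \sum_(j < k) dot (y (idx j)) (x (idx i)) * a 0 j - a 0 i.
Proof.
rewrite mxE.
under eq_bigr do rewrite mxE mulrBr mulrC.
rewrite sumrB; congr (_ - _).
rewrite (bigD1 i)//= eqxx mulr1 big1 ?addr0// => j /negPf ->.
by rewrite mulr0.
Qed.

Lemma coef_systemP n (a : 'rV[C]_k) :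
  coef_system dot idx x y n a <-> a *m erasure_mx = analysis_fin dot idx x (y n).
Proof.
split=> [aP|aP i]; last by rewrite -erasure_mxE aP mxE.
by apply/rowP => i; rewrite erasure_mxE aP mxE.
Qed.

(** A row [a] in the kernel yields [h = sum_j a_j y_(n_j)] with [<h, x_(n_i)> = a_i]. Hence
    [V_E^* U_E h = h], so [h = 0] by [erasure_ker], and [a = 0]. *)
Lemma erasure_mx_unit : erasure_mx \in unitmx.
Proof.
rewrite -row_free_unit; apply: inj_row_free => a aG.
have ai i : \sum_(j < k) dot (y (idx j)) (x (idx i)) * a 0 j = a 0 i.
  by apply/eqP; rewrite -subr_eq0 -erasure_mxE aG mxE.
pose h := synthesis_fin idx y a.
have hx i : dot h (x (idx i)) = a 0 i.
  by rewrite dot_suml -[RHS]ai; apply: eq_bigr => j _; rewrite mulrC.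
have h0 : h = 0.
  apply: erasure_ker; rewrite VUE.
  by under eq_bigr do rewrite hx; rewrite subrr.
by apply/rowP => i; rewrite -hx h0 linear0l mxE.
Qed.

Definition erasure_coef (g : H) : 'rV[C]_k :=
  analysis_fin dot idx x g *m invmx erasure_mx.

(** The Woodbury formula [I - V_E^* (U_E V_E^* - I)^-1 U_E]. At [g = y_n] it is the expression that
    defines [v_n] off [E]. *)
Definition erasure_inv (g : H) : H := g - synthesis_fin idx y (erasure_coef g).

Lemma coef_system_unique n (a : 'rV[C]_k) :
  coef_system dot idx x y n a <-> a = erasure_coef (y n).
Proof.
rewrite coef_systemP /erasure_coef; split=> [<-|->].
  by rewrite mulmxK// erasure_mx_unit.
by rewrite mulmxKV// erasure_mx_unit.
Qed.

(** As [a] solves the system with right-hand side [<g, x_(n_i)>], pairing [g - V_E^* a] with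
    [x_(n_i)] leaves [- a_i]; subtracting [- V_E^* a] then restores [g]. *)
Lemma erasure_invK g : T (erasure_inv g) = g.
Proof.
pose a := erasure_coef g.
have aG : a *m erasure_mx = analysis_fin dot idx x g.
  by rewrite mulmxKV// erasure_mx_unit.
have hx i : dot (erasure_inv g) (x (idx i)) = - a 0 i.
  rewrite dotBl dot_suml; have := erasure_mxE a i; rewrite aG mxE => ->.
  under [X in _ - X]eq_bigr do rewrite mulrC.
  by rewrite addrAC subrr add0r.
rewrite /= VUE; under eq_bigr do rewrite hx scaleNr.
by rewrite sumrN opprK /erasure_inv /synthesis_fin subrK.
Qed.

Lemma bounded_op_rank1 a b : bounded_op (fun h => dot h a *: b).
Proof.
apply: bounded_opP => [c u w|].
  by rewrite scalerA -dotZl -scalerDl; congr (_ *: _); exact: linearDl.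
exists (nm a * nm b) => h; rewrite nmZ mulrAC ler_wpM2r ?nm_ge0// mulrC.
exact: (CauchySchwarz dot_norm).
Qed.

Lemma erasure_is_inverse : is_inverse T erasure_inv.
Proof.
have bT : bounded_op T.
  apply: bounded_op_sub; first exact: bounded_op_id.
  rewrite (funext (VUE dot idx x y)).
  by apply: bounded_op_bigsum => i; exact: bounded_op_rank1.
have bT' : bounded_op erasure_inv.
  apply: bounded_op_sub; first exact: bounded_op_id.
  (* Expanding the matrix product exhibits the correction as a finite sum of rank-one operators,
     each bounded. *)
  pose D i j g := dot g (x (idx j)) *: (invmx erasure_mx j i *: y (idx i)).
  rewrite (_ : (fun _ => _) = fun g => \sum_(i < k) \sum_(j < k) D i j g).
    apply: bounded_op_bigsum => i; apply: bounded_op_bigsum => j.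
    exact: bounded_op_rank1.
  apply/funext => g; apply: eq_bigr => i _.
  rewrite mxE scaler_suml; apply: eq_bigr => j _.
  by rewrite mxE /D scalerA.
split=> // h; last exact: erasure_invK.
(* The left inverse follows from the right one, as [T] is injective. *)
apply/eqP; rewrite -subr_eq0; apply/eqP/erasure_ker.
apply: (etrans (bounded_opB bT _ _)); apply/eqP; rewrite subr_eq0; apply/eqP.
exact: erasure_invK.
Qed.

Section ErasureDual.
Variable v : nat -> H.
Hypothesis v_E : forall n, E n -> v n = 0.
Hypothesis v_J : forall n, (J `\` E) n -> v n = erasure_inv (y n).

Lemma has_sum_erasure_dual h : has_sum J (fun n => dot h (x n) *: v n) h.
Proof.
have [_ bT' TK _] := erasure_is_inverse.
have := has_sum_bounded_op bT' (@has_sum_erasure h).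
rewrite TK; apply: eq_has_sum => n Jn /=; case: ifPn => [|nE].
  by rewrite inE => /v_E ->; rewrite (bounded_op0 bT') scaler0.
by rewrite (bounded_opZ bT') v_J//; split=> //; move: nE; rewrite notin_setE.
Qed.

(** Off [E], [v_n = W x_n] with [W = T^-1 S^-1] bounded by [K]. Passing through synthesis lets [W]
    act on the sum directly, whereas moving it across [dot] would require its adjoint. *)
Lemma erasure_dual_bessel : exists2 M : R, 0 < M & bessel dot J v M.
Proof.
have [B B0 xB] := frame_bessel x_frame.
have [_ bT' _ _] := erasure_is_inverse; have [_ bS' _ _] := inv_S.
have bW := bounded_op_comp bT' bS'.
have [K K0 WK] := bounded_op_nm bW.
exists (K ^+ 2 * B) => [|h N]; first by rewrite mulr_gt0// exprn_gt0.
apply: (bessel_of_synthesis_le dot_norm); first by rewrite mulr_gt0// exprn_gt0.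
(* Zeroing the coefficients on [E] accounts for [v_n = 0] there and can only decrease the sum of
   squares. *)
move=> c; pose c' n := if n \in E then 0 else c n.
have -> : \sum_(0 <= n < N | n \in J) c n *: v n =
    (erasure_inv \o S') (\sum_(0 <= n < N | n \in J) c' n *: x n).
  rewrite (bounded_op_sum bW); apply: eq_bigr => n; rewrite inE => Jn.
  rewrite (bounded_opZ bW) /c'; case: ifPn => [|nE].
    by rewrite inE => /v_E ->; rewrite scaler0 scale0r.
  by rewrite v_J ?y_def//; split=> //; move: nE; rewrite notin_setE.
set z := \sum_(0 <= n < N | n \in J) c' n *: x n.
rewrite (@le_trans _ _ ((K * nm z) ^+ 2))//.
  by rewrite ler_pXn2r ?nnegrE ?mulr_ge0 ?nm_ge0 ?(ltW K0).
rewrite exprMn -mulrA ler_pM2l ?exprn_gt0//.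
rewrite (le_trans (bessel_synthesis_le dot_norm B0 xB _ _ _))// ler_pM2l//.
apply: ler_sum => n _; rewrite /c'; case: ifP => // _.
by rewrite nm0 expr0n sqr_ge0.
Qed.

(** For the lower bound, [|h|^2 = sum <h, x_n> <v_n, h>] and AM-GM with [t = B^-1] give
    [2 B^-1 |h|^2 <= B^-1 |h|^2 + s], where [s] is the sum of the [|<h, v_n>|^2]. *)
Lemma erasure_dual_is_frame : is_frame dot J v.
Proof.
have [B B0 xB] := frame_bessel x_frame.
have [M M0 vM] := erasure_dual_bessel.
apply/is_frameP; exists B^-1, M; split=> // [|h]; first by rewrite invr_gt0.
have [s [sM hs]] := has_sum_bounded (fun n => sqr_ge0 (nm (dot h (v n)))) (vM h).
exists s; split=> //; rewrite sM andbT.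
have {hs} [/= hs _] := has_sum_real hs.
have t0 : 0 < B^-1 by rewrite invr_gt0.
have := has_sum_dotl dot_norm (g := h) (@has_sum_erasure_dual h).
rewrite (dot_nm dot_norm) => hh.
have pN N : nm (\sum_(0 <= n < N | n \in J) dot (dot h (x n) *: v n) h) <=
    (B^-1 * nm h ^+ 2 + s) / (2 * B^-1).
  rewrite ler_pdivlMr ?mulr_gt0// mulrC.
  under eq_bigr do rewrite dotZl.
  rewrite (le_trans (ler_nm_sumM _ _ _ _ (ltW t0)))//; apply: lerD.
    by rewrite expr2 -mulrA ler_pM2l// ler_pdivrMl.
  under eq_bigr do rewrite (dotC dot) nm_conj.
  by apply: (psum_le _ _ hs) => n; exact: sqr_ge0.
have := nm_le_cvg hh pN; rewrite nm_real ger0_norm ?sqr_ge0//.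
rewrite ler_pdivlMr ?mulr_gt0// mulrC.
by move: (B^-1) (nm h ^+ 2) => b X; nra.
Qed.

End ErasureDual.
End Erasure.

Theorem theorem3p2 (R : realType) (H : completeNormedModType R[i])
  (dot : {dot H for @Num.conj R[i]})
  (dot_norm : forall h, dot h h = `|h| ^+ 2)
  (J : set nat) (HJ : is_index_set H J)
  (x y : nat -> H)
  (x_frame : is_frame dot J x)
  (y_def : forall n, J n -> y n = canonical_dual dot J x n)
  (k : nat) (k_gt0 : (0 < k)%N)
  (idx : 'I_k -> nat) (idx_inj : injective idx)
  (E : set nat) (E_def : E = range idx) (EJ : E `<=` J)
  (E_mr : minimal_redundancy J E x) :
  (forall n, (J `\` E) n -> exists! a : 'rV[R[i]]_k, coef_system dot idx x y n a) /\
  forall (alpha : nat -> 'rV[R[i]]_k) (v : nat -> H),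
    (forall n, (J `\` E) n -> coef_system dot idx x y n (alpha n)) ->
    (forall n, E n -> v n = 0) ->
    (forall n, (J `\` E) n ->
       v n = y n - \sum_(i < k) alpha n 0 i *: y (idx i)) ->
  [/\ is_dual_frame dot J x v,
      invertible (fun h => h - VU dot idx x y h) &
      forall n, (J `\` E) n -> v n = op_inv (fun h => h - VU dot idx x y h) (y n)].
Proof.
have coefP := coef_system_unique dot_norm x_frame y_def idx_inj E_def EJ E_mr.
split=> [n _|alpha v alphaP vE vJ].
  by exists (erasure_coef dot x y idx (y n)); split=> [|a /coefP]; [exact/coefP|].
have {}vJ n : (J `\` E) n -> v n = erasure_inv dot x y idx (y n).
  by move=> En; rewrite vJ//; have /coefP -> := alphaP _ En.
have invT := erasure_is_inverse dot_norm x_frame y_def idx_inj E_def EJ E_mr.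
have iT : invertible (fun h => h - VU dot idx x y h) by exists (erasure_inv dot x y idx).
split=> // [|n En].
  split; first exact: (erasure_dual_is_frame dot_norm x_frame y_def idx_inj E_def EJ E_mr).
  exact: (has_sum_erasure_dual dot_norm x_frame y_def idx_inj E_def EJ E_mr).
(* [op_inv] is some inverse chosen by [get]; writing [y n] as [T] of [erasure_inv] at [y n] and
   cancelling shows that both inverses agree there. *)
have [_ _ TK _] := op_invP iT; have [_ _ _ T'K] := invT.
by rewrite vJ// -{2}(T'K (y n)) TK.
Qed.
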